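(* Consider the delayed linear system \[ \dot x_i(t)=g_i(y_i)+\frac{K}{c_i}\sum_{j\in\mathcal N_i}a_{ij}\bigl(x_j(t-\tau_{ij})-x_i(t)\bigr),\quad t>0,\qquad x_i(t)=\phi_i(t),\ t\in[-\tau,0],\quad i=1,\dots,N, \] and assume: (a1) $K>0$ and $c_i>0$ for all $i$; (a2) the delays satisfy $0\le\tau_{ij}\le\tau:=\max_{i\neq j}\tau_{ij}<+\infty$; (a3) the initial functions $\phi_i$ are continuous and bounded on $[-\tau,0]$. Let $\mathbf L$ be the Laplacian of the associated digraph $\mathscr G$ and let $\boldsymbol\gamma=(\gamma_1,\dots,\gamma_N)^T$ be a left eigenvector of $\mathbf L$ for the eigenvalue $0$, i.e. $\boldsymbol\gamma^T\mathbf L=\mathbf 0^T$, normalized with $\|\boldsymbol\gamma\|=1$ and sign chosen so that its entries are nonnegative. Then the system globally synchronizes for every choice of finite delays $\{\tau_{ij}\}$ if and only if $\mathscr G$ is quasi-strongly connected. In that case the synchronized state (common limit of all state derivatives) is \[ \omega^\star=\frac{\sum_{i=1}^N\gamma_i c_i g_i(y_i)}{\sum_{i=1}^N\gamma_i c_i+K\sum_{i=1}^N\sum_{j\in\mathcal N_i}\gamma_i a_{ij}\tau_{ij}}, \] where $\gamma_i>0$ if and only if node $i$ can reach all other nodes of $\mathscr G$ through a directed path, and $\gamma_i=0$ otherwise.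
   Context: Network of $N$ nodes. Node $i$ has a scalar measurement $y_i\in\mathbb R$, a real function $g_i:\mathbb R\to\mathbb R$, a coefficient $c_i>0$, and a scalar state $x_i(t)$. $K>0$ is a coupling gain. For $i\neq j$, $a_{ij}\ge 0$ is a link coefficient (in general $a_{ij}\neq a_{ji}$), $\mathcal N_i=\{j\neq i: a_{ij}\neq 0\}$, and $\tau_{ij}\ge0$ is a constant delay on the link from $j$ to $i$. Digraph $\mathscr G$: vertices $\{1,\dots,N\}$, with a directed edge from $j$ to $i$ (information flows from $j$ to $i$) of weight $a_{ij}$ whenever $a_{ij}>0$. Adjacency matrix $[\mathbf A]_{ij}=a_{ij}$ (zero diagonal), $\mathbf D=\mathrm{diag}(\sum_j a_{1j},\dots,\sum_j a_{Nj})$, Laplacian $\mathbf L=\mathbf D-\mathbf A$. Node $i$ reaches node $j$ if there is a directed path from $i$ to $j$ along edges. $\mathscr G$ is quasi-strongly connected (QSC) if for every ordered pair of nodes $u,v$ there exists a node $r$ that reaches both $u$ and $v$. Synchronization: a solution $\{x_i^\star(t)\}$ is a synchronized state if $\dot x_i^\star(t)=\omega^\star$ for all $i$ and $t$, with $\omega^\star$ constant. The system globally synchronizes if a synchronized state exists and, for every admissible set of initial functions $\{\phi_i\}$, every solution satisfies $\lim_{t\to\infty}|\dot x_i(t)-\omega^\star|=0$ for all $i$.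
   Formalization: The equivalence is stated with global synchronization required for every choice of finite delays and also of the node data g_i, y_i; for fixed data ''only if'' fails (e.g. two unlinked nodes with g_1(y_1)=g_2(y_2)). *)

(* Defs.v *)
From HB Require Import structures.
From mathcomp Require Import all_boot all_order all_algebra.
From mathcomp Require Import all_classical all_reals all_analysis.
Set Implicit Arguments. Unset Strict Implicit. Unset Printing Implicit Defensive.
Import Order.TTheory GRing.Theory Num.Theory.
Import numFieldNormedType.Exports.
Local Open Scope classical_set_scope.
Local Open Scope ring_scope.

Section Network.
Variables (R : realType) (N : nat).
Implicit Types (a tau : 'I_N -> 'I_N -> R) (c : 'I_N -> R) (K : R) (g : 'I_N -> R -> R) (y : 'I_N -> R) (t : R).

Definition nbrs a (i : 'I_N) : pred 'I_N := [pred j | (j != i) && (a i j != 0)].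

Definition adjmx a : 'M[R]_N := \matrix_(i, j) (if i == j then 0 else a i j).
Definition degmx a : 'M[R]_N :=
  \matrix_(i, j) (if i == j then \sum_(k < N) adjmx a i k else 0).
Definition laplacian a : 'M[R]_N := degmx a - adjmx a.

Definition edge a : rel 'I_N := fun j i => (j != i) && (0 < a i j).
Definition reaches a (u v : 'I_N) : bool := connect (edge a) u v.
Definition QSC a : Prop := forall u v : 'I_N, exists r, reaches a r u /\ reaches a r v.

Definition taumax tau : R :=
  \big[Num.max/0]_(i < N) \big[Num.max/0]_(j < N | j != i) tau i j.

Definition admissible (T : R) (phi : 'I_N -> R -> R) : Prop :=
  forall i, {within [set t | - T <= t <= 0], continuous (phi i)} /\
            exists M : R, forall t : R, - T <= t <= 0 -> `|phi i t| <= M.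

Definition rhs K c a (g : 'I_N -> R -> R) (y : 'I_N -> R) tau
    (x : 'I_N -> R -> R) (i : 'I_N) (t : R) : R :=
  g i (y i) + K / c i * \sum_(j in nbrs a i) a i j * (x j (t - tau i j) - x i t).

Definition is_solution K c a g y tau (phi x : 'I_N -> R -> R) : Prop :=
  forall i,
    (forall t : R, - taumax tau <= t <= 0 -> x i t = phi i t) /\
    {within [set t | - taumax tau <= t], continuous (x i)} /\
    (forall t : R, 0 < t -> is_derive t (1 : R) (x i) (rhs K c a g y tau x i t)).

Definition sync_state K c a g y tau (w : R) : Prop :=
  exists phi x, admissible (taumax tau) phi /\ is_solution K c a g y tau phi x /\
    forall i (t : R), 0 < t -> is_derive t (1 : R) (x i) w.

Definition glob_sync_to K c a g y tau (w : R) : Prop :=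
  sync_state K c a g y tau w /\
  forall phi x, admissible (taumax tau) phi -> is_solution K c a g y tau phi x ->
    forall i, (fun t => `|derive1 (x i) t - w|) @ +oo --> (0 : R).

Definition glob_sync K c a g y tau : Prop := exists w, glob_sync_to K c a g y tau w.

Definition omega_star K c a (g : 'I_N -> R -> R) (y : 'I_N -> R) tau (gamma : 'rV[R]_N) : R :=
  (\sum_(i < N) gamma 0 i * c i * g i (y i)) /
  (\sum_(i < N) gamma 0 i * c i +
   K * \sum_(i < N) \sum_(j in nbrs a i) gamma 0 i * a i j * tau i j).

End Network.

(* Main.v *)
Require Import Defs.
From HB Require Import structures.
From mathcomp Require Import all_boot all_order all_algebra.
From mathcomp Require Import all_classical all_reals all_analysis.
From mathcomp Require Import ring lra.

(* Sufficiency: a drift [om] and potentials [b] with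
   [g_i + sum_j rate_ij (b_j - om tau_ij - b_i) = om] exist because the Laplacian
   kernel of a digraph with a root consists of constants while its range contains
   no positive vector; weighting by [gamma_i c_i] identifies [om].  For any
   solution [x], [z_i t = x_i t - (om t + b_i)] solves a delayed consensus system.
   By a maximum principle, bounds on [z] over one delay window persist forever.
   The root contributes, within a fixed time, a fixed fraction of its distance to
   either bound to every node, so the width of the bounds contracts geometrically
   and the derivative of [z] tends to [0].
   Necessity: if [u] and [v] have no common ancestor, take zero delays and [g = 1]
   on the ancestors of [u], [g = 0] elsewhere; evaluating at the extremal states
   among the ancestors of [u] and of [v], a common drift would be both [1] and [0]. *)

Import Order.TTheory GRing.Theory Num.Theory.
Import numFieldNormedType.Exports.
Local Open Scope classical_set_scope.
Local Open Scope ring_scope.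
Set Implicit Arguments. Unset Strict Implicit. Unset Printing Implicit Defensive.

(** * One-sided extrema and an integrating factor *)

Section RealFunctions.
Variable R : realType.
Implicit Types (f : R -> R) (t : R).

(** All left difference quotients at [c] are nonnegative. Only the left side is assumed, so that a
    maximum at the right end of a time interval is covered. *)
Lemma is_derive_ge0_left_max f (a c df : R) :
  a < c -> is_derive c 1 f df -> (forall t, a <= t <= c -> f t <= f c) -> 0 <= df.
Proof.
move=> ac dfc fmax; have dc : derivable f c 1 by exact: (@ex_derive _ _ _ _ _ _ _ dfc).
rewrite -(derive_val : 'D_1 f c = df) ['D_1 f c]cvg_at_leftE//.
apply: limr_ge.
  rewrite -(cvg_at_leftE (fun h => h^-1 *: ((f \o shift c) _ - f c)))//.
  apply: cvg_trans dc; apply: cvg_app => A [e egt0 Ae]; exists e => // x xe xgt0.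
  by apply: Ae => //; exact/ltr0_neq0.
near=> h; apply: mulr_le0.
  by rewrite invr_le0; apply: ltW; near: h; exists 1 => /=.
rewrite subr_le0 [_%:A]mulr1; apply: fmax; near: h.
exists (c - a); rewrite /= ?subr_gt0// => h/=; rewrite sub0r normrN => /ltr_normlP[h1 h2] h0.
by apply/andP; split; lra.
Unshelve. all: by end_near. Qed.

(** The integrating factor [expR (B * x)] turns [df x + B * f x] into the derivative of a product,
    and the mean value theorem bounds its increment. *)
Lemma expR_weighted_growth f (df : R -> R) (B h s t : R) : s <= t ->
  {within `[s, t], continuous f} ->
  (forall x, x \in `]s, t[ -> is_derive x 1 f (df x)) ->
  (forall x, x \in `]s, t[ -> h * expR (- (B * x)) <= df x + B * f x) ->
  f s * expR (B * s) + h * (t - s) <= f t * expR (B * t).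
Proof.
rewrite le_eqVlt => /predU1P[->|st] fc fd fB; first by rewrite subrr mulr0 addr0.
pose E x : R := expR (B * x).
have Ed (x : R) : is_derive x 1 E (B * E x).
  have H1 : is_derive x 1 (fun y : R => B * y) B.
    by apply: is_derive_eq; rewrite scaler1.
  by rewrite mulrC; exact: (@is_derive1_comp _ expR (fun y : R => B * y)).
have Ec : {within `[s, t], continuous E}.
  by apply: derivable_within_continuous => x _; exact: ex_derive.
have Fd (x : R) : x \in `]s, t[ -> is_derive x 1 (f \* E) ((df x + B * f x) * E x).
  move=> /fd fdx; apply: (is_derive_eq (is_deriveM fdx (Ed x))).
  by rewrite /GRing.scale/=; ring.
have Fc : {within `[s, t], continuous (f \* E)}.
  by move=> x; apply: cvgM; [exact: fc|exact: Ec].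
have [x xst] := MVT st Fd Fc; rewrite /= -/(E s) -/(E t) => /eqP.
rewrite subr_eq addrC => /eqP ->; rewrite lerD2l ler_wpM2r//; first by rewrite subr_ge0 ltW.
by rewrite /E -ler_pdivrMr ?expR_gt0// -expRN; exact: fB.
Qed.

End RealFunctions.

Lemma connect_ind (V : finType) (e : rel V) (P : V -> Prop) (u v : V) :
  (forall x y, e x y -> P x -> P y) -> connect e u v -> P u -> P v.
Proof.
move=> eP /connectP[p + ->]; elim: p u => //= x p IH u /andP[ux /IH {}IH] Pu.
exact/IH/(eP u).
Qed.

(** * Delayed consensus flows and their contraction *)

Section DelayedConsensus.
Variables (R : realType) (N : nat) (w d : 'I_N -> 'I_N -> R) (T : R).
Hypotheses (w_ge0 : forall i j, 0 <= w i j) (d_ge0 : forall i j, 0 <= d i j)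
  (d_le : forall i j, d i j <= T).
Implicit Types (z : 'I_N -> R -> R) (i j r : 'I_N) (t : R).

Definition consensus_flow z := forall i,
  {within [set t | 0 <= t], continuous (z i)} /\
  forall t, 0 < t -> is_derive t 1 (z i) (\sum_j w i j * (z j (t - d i j) - z i t)).

Lemma consensus_flow_affine z (s k : R) :
  consensus_flow z -> consensus_flow (fun i t => s * z i t + k).
Proof.
move=> zf i; have [zc zd] := zf i; split.
  move=> t; apply: cvgD; last exact: cvg_cst.
  by apply: cvgM; [exact: cvg_cst|exact: zc].
move=> t t0; have := zd _ t0 => dz.
have H : is_derive t 1 (fun t => s * z i t + k) (s * (\sum_j w i j * (z j (t - d i j) - z i t)) + 0).
  exact: is_deriveD.
apply: (is_derive_eq H); rewrite addr0 mulr_sumr; apply: eq_bigr => j _; ring.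
Qed.

Lemma consensus_flow_ub z (t0 C : R) : consensus_flow z -> 0 <= t0 ->
  (forall i t, t0 - T <= t <= t0 -> z i t <= C) ->
  forall i t, t0 - T <= t -> z i t <= C.
Proof.
move=> zf t0_ge0 zC i t tT; case: (leP t t0) => [tt0|t0t]; first by apply: zC; rewrite tT.
(* the maximum over all nodes and [t0, t] of [z - e (t - t0)] cannot exceed [C] *)
have T_ge0 : 0 <= T by rewrite (le_trans (d_ge0 i i)).
(* [e] is scaled so that the tilt at time [t] is exactly the slack [e']. *)
apply/ler_addgt0Pr => e' e'0; pose e := e' / (t - t0).
have e0 : 0 < e by rewrite divr_gt0// subr_gt0.
have -> : e' = e * (t - t0) by rewrite divfK// gt_eqF// subr_gt0.
pose p j x : R := z j x - e * (x - t0).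
suff : p i t <= C by rewrite lerBlDr.
have pd j (x : R) : 0 < x -> is_derive x 1 (p j)
    (\sum_k w j k * (z k (x - d j k) - z j x) - e).
  move=> x0; have [_ /(_ _ x0) dz] := zf j.
  have H : is_derive x 1 (fun x : R => e * (x - t0)) e.
    by apply: is_derive_eq; rewrite oppr0 addr0 scaler1.
  exact: is_deriveB.
have pc j : {within `[t0, t], continuous (p j)}.
  move=> x; apply: cvgB.
    have [zc _] := zf j; apply: (continuous_subspaceW _ zc) => y /=.
    by rewrite in_itv/= => /andP[]; lra.
  have : continuous (fun x : R => e * (x - t0)).
    move=> y; apply: cvgM; first exact: cvg_cst.
    by apply: cvgB; [exact: cvg_id|exact: cvg_cst].
  by move=> /continuous_subspaceT; exact.
have /fin_all_exists2[m mI mP] : forall j, exists2 c, c \in `[t0, t] &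
    forall x, x \in `[t0, t] -> p j x <= p j c.
  by move=> j; apply: EVT_max => //; exact: ltW.
case: (@Order.TotalTheory.arg_maxP _ _ _ i xpredT (fun j => p j (m j))) => // j _ jmax.
have gmax k x : t0 <= x <= t -> p k x <= p j (m j).
  by move=> xI; apply: le_trans (jmax k isT); apply: mP; rewrite in_itv.
have [mt0 mt] : t0 <= m j /\ m j <= t by apply/andP; have := mI j; rewrite in_itv.
apply: (le_trans (gmax i t _)); first by rewrite lexx ltW.
rewrite leNgt; apply/negP => Cp.
have t0m : t0 < m j.
  rewrite lt_neqAle mt0 andbT; apply/eqP => t0E; move: Cp; rewrite -t0E /p subrr mulr0 subr0.
  by rewrite ltNge zC// lexx andbT gerBl.
have : 0 <= \sum_k w j k * (z k (m j - d j k) - z j (m j)) - e.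
  apply: (is_derive_ge0_left_max t0m (pd _ _ _)); first exact: le_lt_trans t0m.
  move=> x /andP[x1 x2]; apply: gmax; rewrite x1/=; exact: le_trans mt.
(* The left maximum forces a nonnegative derivative, but every coupling term is at most 0 and the
   tilt contributes [- e]. *)
apply/negP; rewrite -ltNge subr_lt0; apply: (le_lt_trans _ e0); apply: sumr_le0 => k _.
rewrite mulr_ge0_le0// subr_le0.
have := d_ge0 j k; have := d_le j k => d1 d2.
have em : 0 <= e * (m j - t0) by rewrite mulr_ge0 ?subr_ge0// ltW.
(* The delayed time falls either in the initial window, where [C] is a bound, or in [[t0, m j]],
   where maximality applies and the tilt is no larger than at [m j]. *)
case: (leP (m j - d j k) t0) => mdt.
  apply: (@le_trans _ _ C); first by apply: zC; rewrite mdt andbT; lra.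
  by move: Cp; rewrite /p; lra.
have : p k (m j - d j k) <= p j (m j) by apply: gmax; rewrite ltW//=; lra.
have ed : 0 <= e * d j k by rewrite mulr_ge0// ltW.
rewrite /p; lra.
Qed.

Lemma consensus_flow_lb z (t0 C : R) : consensus_flow z -> 0 <= t0 ->
  (forall i t, t0 - T <= t <= t0 -> C <= z i t) ->
  forall i t, t0 - T <= t -> C <= z i t.
Proof.
move=> /(consensus_flow_affine (-1) 0) zf t0_ge0 zC i t tT.
have := consensus_flow_ub (C := - C) zf t0_ge0 _ i tT.
rewrite mulN1r addr0 lerN2; apply => j x xI.
by rewrite mulN1r addr0 lerN2 zC.
Qed.

(** Dominates the total incoming rate of every node, so one weight [expR (B * t)] offsets the decay
    term at all nodes. *)
Local Notation B := (\sum_i \sum_j w i j).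

(** For a nonnegative flow, dropping all inflow but that of [k] and absorbing the decay into [B]
    reduces the claim to [expR_weighted_growth]. *)
Lemma consensus_flow_growth z i (t0 h s t : R) :
  consensus_flow z -> 0 <= t0 ->
  (forall j t, t0 - T <= t -> 0 <= z j t) -> t0 <= s <= t ->
  (exists k, forall x, s < x -> h * expR (- (B * x)) <= w i k * z k (x - d i k)) ->
  z i s * expR (B * s) + h * (t - s) <= z i t * expR (B * t).
Proof.
move=> zf t00 z0 /andP[t0s st] [k hk]; have [zc zd] := zf i.
apply: (expR_weighted_growth st (df := fun t => \sum_j w i j * (z j (t - d i j) - z i t))).
- apply: (continuous_subspaceW _ zc) => x /=; rewrite in_itv/= => /andP[sx _].
  exact/(le_trans t00)/(le_trans t0s).
- by move=> x; rewrite in_itv/= => /andP[sx _]; apply: zd; apply: le_lt_trans sx; exact: le_trans t0s.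
move=> x; rewrite in_itv/= => /andP[sx _].
apply: (le_trans (hk _ sx)).
have zx j : 0 <= z j (x - d i j) by apply: z0; have := d_le i j; lra.
have -> : \sum_j w i j * (z j (x - d i j) - z i x) =
    \sum_j w i j * z j (x - d i j) - (\sum_j w i j) * z i x.
  by rewrite mulr_suml -sumrB; apply: eq_bigr => j _; rewrite mulrBr.
rewrite -addrA -lerBlDl.
apply: (@le_trans _ _ 0).
  by rewrite subr_le0 (bigD1 k)//= lerDl sumr_ge0// => j _; rewrite mulr_ge0.
have zix : 0 <= z i x.
  apply: z0; have := d_ge0 i i; have := d_le i i; lra.
rewrite addrC subr_ge0 ler_wpM2r// [leRHS](bigD1 i)//= lerDl sumr_ge0// => j _.
exact: sumr_ge0.
Qed.

(** [h] and [e] are chosen before [z] and [t0], so the gain is uniform over flows and starting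
    times. The exponential weight lets the bound hold at all later times. *)
Definition lower_reach r i :=
  exists h e : R, [/\ 0 <= h, 0 < e & forall z t0, consensus_flow z -> 0 <= t0 ->
  (forall j t, t0 - T <= t -> 0 <= z j t) ->
  forall t, t0 + h <= t -> e * (z r t0 * expR (B * t0)) <= z i t * expR (B * t)].

Lemma connect_lower_reach r i :
  connect (fun j k => 0 < w k j) r i -> lower_reach r i.
Proof.
have T_ge0 : 0 <= T by rewrite (le_trans (d_ge0 r r)).
move=> ri; apply: (connect_ind (P := lower_reach r) _ ri) => [j k jk [h [e [h0 e0 IH]]]|].
  (* Waiting [T] more makes the delayed values of [j] subject to the induction hypothesis; one
     further unit of time gives [t - s >= 1], over which [k] accumulates at least [c]. *)
  exists (h + T + 1), (w k j * e); split; [lra|exact: mulr_gt0|].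
  move=> z t0 zf t00 z0 t tt; have {}IH := IH z t0 zf t00 z0.
  pose s := t0 + h + T.
  have ts : t0 <= s <= t by rewrite /s; lra.
  have zr : 0 <= z r t0 * expR (B * t0) by rewrite mulr_ge0 ?expR_ge0// z0// gerBl.
  have zk : 0 <= z k s * expR (B * s).
    by rewrite mulr_ge0 ?expR_ge0// z0//; rewrite /s; lra.
  have B_ge0 : 0 <= B by apply: sumr_ge0 => *; exact: sumr_ge0.
  set c := w k j * e * (z r t0 * expR (B * t0)).
  have c0 : 0 <= c by rewrite mulr_ge0// mulr_ge0// ltW.
  have : z k s * expR (B * s) + c * (t - s) <= z k t * expR (B * t).
    apply: (consensus_flow_growth zf t00 z0 ts); exists j => x sx.
    rewrite expRN ler_pdivrMr ?expR_gt0// /c -!mulrA ler_wpM2l//.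
    have dkj := d_le k j.
    apply: (le_trans (IH (x - d k j) _)); first by move: sx; rewrite /s; lra.
    rewrite ler_wpM2l//; first by apply: z0; move: sx; rewrite /s; lra.
    by rewrite ler_expR ler_wpM2l// gerBl.
  apply: le_trans; apply: (@le_trans _ _ (c * (t - s))); last by rewrite lerDr.
  by rewrite -[leLHS]mulr1 ler_wpM2l// /s; lra.
(* Empty path: growth with [h = 0] says that the weighted root value never decreases. *)
exists 0, 1; split => // z t0 zf t00 z0 t; rewrite addr0 mul1r => tt.
have := @consensus_flow_growth z r t0 0 t0 t zf t00 z0.
rewrite lexx tt mul0r addr0; apply=> //; exists r => x tx.
by rewrite mul0r mulr_ge0// z0//; have := d_le r r; lra.
Qed.

(** The root is fixed for the contraction results. The next lemma removes the weight and covers all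
    nodes on a full delay window, the form that the maximum principle takes as input. *)
Hypothesis (r : 'I_N) (r_root : forall i, connect (fun j k => 0 < w k j) r i).

Lemma consensus_flow_raise : exists h q : R, [/\ 0 <= h, 0 < q < 1 &
  forall z t0, consensus_flow z -> 0 <= t0 ->
  (forall j t, t0 - T <= t -> 0 <= z j t) ->
  forall j t, t0 + h - T <= t <= t0 + h -> q * z r t0 <= z j t].
Proof.
have T_ge0 : 0 <= T by rewrite (le_trans (d_ge0 r r)).
have [h /fin_all_exists[e he]] := fin_all_exists (fun i => connect_lower_reach (r_root i)).
(* [S] bounds every waiting time, and adding [T] puts the whole window after all of them. [E] is
   positive and below every fraction. *)
pose S := \sum_i h i; pose H := S + T; pose E := \big[Num.min/1]_i e i.
have H0 : 0 <= H by rewrite addr_ge0// sumr_ge0// => i _; have [] := he i.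
have E0 : 0 < E by rewrite /E; elim/big_ind : _ => // [x y|i _]; [rewrite lt_min => -> ->|have [] := he i].
have B_ge0 : 0 <= B by apply: sumr_ge0 => *; exact: sumr_ge0.
(* [expR (- (B * H))] is the worst loss from removing the weight; [1/2] keeps the fraction below
   1. *)
exists H, (Num.min (1/2) (E * expR (- (B * H)))); split => //.
  have EB : 0 < E * expR (- (B * H)) by rewrite mulr_gt0 ?expR_gt0.
  by rewrite lt_min gt_min EB andbT; apply/andP; split; [lra|apply/orP; left; lra].
move=> z t0 zf t00 z0 j t /andP[t1 t2].
have zr : 0 <= z r t0 by apply: z0; lra.
apply: (@le_trans _ _ (E * expR (- (B * H)) * z r t0)).
  by rewrite ler_wpM2r// ge_min lexx orbT.
have [h0 e0 /(_ z t0 zf t00 z0 t)] := he j.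
have hj : h j <= S.
  by rewrite /S (bigD1 j)//= lerDl sumr_ge0// => i _; have [] := he i.
have -> : t0 + h j <= t by rewrite /H in t1 t2; lra.
move=> /(_ isT); rewrite -ler_pdivrMr ?expR_gt0// -expRN; apply: le_trans.
have -> : e j * (z r t0 * expR (B * t0)) * expR (- (B * t)) =
    e j * expR (B * (t0 - t)) * z r t0 by rewrite mulrBr expRD; ring.
rewrite ler_wpM2r// ler_pM ?expR_ge0//; first exact: ltW.
  by rewrite /E (bigD1 j)//= ge_min lexx.
by rewrite ler_expR -mulrN ler_wpM2l//; rewrite /H in t1 t2 *; lra.
Qed.

(* [z] or its reflection is large at the root, which raises the lower or lowers
   the upper bound of every node. *)
Lemma consensus_flow_contraction : exists h q : R, [/\ 0 <= h, 0 <= q < 1 &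
  forall z t0 (m M : R), consensus_flow z -> 0 <= t0 ->
  (forall j t, t0 - T <= t -> m <= z j t <= M) ->
  exists m' M' : R, M' - m' = q * (M - m) /\ forall j t, t0 + h - T <= t -> m' <= z j t <= M'].
Proof.
have [h [q [h0 /andP[q0 q1] hq]]] := consensus_flow_raise.
have T_ge0 : 0 <= T by rewrite (le_trans (d_ge0 r r)).
(* The root is at least half the width away from one of the bounds, and a fraction [q] of that half
   is gained. *)
exists h, (1 - q / 2); split => //; first lra.
move=> z t0 m M zf t00 zmM.
have tS j t : t0 + h - T <= t -> m <= z j t <= M by move=> tt; apply: zmM; lra.
have th : 0 <= t0 + h by rewrite addr_ge0.
have mr : m <= z r t0 <= M by apply: zmM; lra.
case: (lerP ((m + M) / 2) (z r t0)) => mM.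
  exists (m + q * ((M - m) / 2)), M; split; first by field.
  move=> j t tt; have /andP[_ ->] := tS j t tt; rewrite andbT.
  apply: (consensus_flow_lb zf th) tt => {}j {}t tt.
  have H k x : t0 - T <= x -> 0 <= 1 * z k x - m.
    by move=> /(zmM k)/andP[? _]; rewrite mul1r subr_ge0.
  have qz : q * ((M - m) / 2) <= q * (z r t0 - m). by rewrite ler_wpM2l ?(ltW q0)//; lra.
  have := hq _ _ (consensus_flow_affine 1 (- m) zf) t00 H j t tt.
  rewrite /= !mul1r; lra.
exists m, (M - q * ((M - m) / 2)); split; first by field.
move=> j t tt; have /andP[-> _] := tS j t tt; rewrite /=.
apply: (consensus_flow_ub zf th) tt => {}j {}t tt.
have H k x : t0 - T <= x -> 0 <= -1 * z k x + M.
  by move=> /(zmM k)/andP[_ ?]; rewrite mulN1r addrC subr_ge0.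
have qz : q * ((M - m) / 2) <= q * (- z r t0 + M) by rewrite ler_wpM2l ?(ltW q0)//; lra.
have := hq _ _ (consensus_flow_affine (-1) M zf) t00 H j t tt.
rewrite /= !mulN1r; lra.
Qed.

(** The derivative is at most the total incoming rate times the width of the current bounds, and
    iterated contraction makes this width geometric. *)
Lemma consensus_flow_derive_cvg0 z (M : R) : consensus_flow z ->
  (forall j t, - T <= t <= 0 -> `|z j t| <= M) ->
  forall i, \sum_j w i j * (z j (t - d i j) - z i t) @[t --> +oo] --> (0 : R).
Proof.
move=> zf zM i; have [h [q [h0 /andP[q0 q1] step]]] := consensus_flow_contraction.
have T_ge0 : 0 <= T by rewrite (le_trans (d_ge0 r r)).
have zM' j t : 0 - T <= t -> - M <= z j t <= M.
  move=> tT; apply/andP; split.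
    apply: (consensus_flow_lb zf) tT => // k x xI.
    by have := zM k x; rewrite ler_norml -(sub0r T) xI => /(_ isT)/andP[].
  apply: (consensus_flow_ub zf) tT => // k x xI.
  by have := zM k x; rewrite ler_norml -(sub0r T) xI => /(_ isT)/andP[].
have osc n : exists m' M' : R, M' - m' = q ^+ n * (M + M) /\
    forall j t, n%:R * h - T <= t -> m' <= z j t <= M'.
  elim: n => [|n [m' [M' [mM' zn]]]].
    by exists (- M), M; rewrite mul0r expr0 mul1r opprK.
  have nh : 0 <= n%:R * h by rewrite mulr_ge0.
  have [m2 [M2 [E zn2]]] := step z _ _ _ zf nh zn.
  exists m2, M2; rewrite E mM' exprS mulrA; split=> // j t tt; apply: zn2.
  by apply: le_trans tt; rewrite -natr1 mulrDl mul1r.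
have B0 : 0 <= \sum_j w i j by exact: sumr_ge0.
apply/cvgr0Pnorm_le => e e0.
have /cvgr0Pnorm_le/(_ _ e0) : geometric ((\sum_j w i j) * (M + M)) q n @[n --> \oo] --> (0 : R).
  by apply: cvg_geometric; rewrite ger0_norm.
move=> [n _ /(_ n (leqnn n))]; rewrite /= => ne.
have [m' [M' [mM' zn]]] := osc n.
near=> t; have tn : n%:R * h <= t by near: t; apply: nbhs_pinfty_ge; exact: num_real.
apply: (le_trans _ ne); apply: (le_trans (ler_norm_sum _ _ _)).
apply: le_trans (ler_norm _).
rewrite mulrAC -mulrA -mM' mulr_suml; apply: ler_sum => j _.
rewrite normrM ger0_norm// ler_wpM2l//.
(* Once [t >= n%:R * h], both [t] and [t - d i j] lie beyond [n%:R * h - T], so the bounds of stage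
   [n] hold for both values. *)
have := zn j (t - d i j); have := zn i t; have := d_ge0 i j; have := d_le i j => d1 d2.
move=> /(_ _)/andP[|z1 z2]; first by rewrite lerBlDr (le_trans tn)// lerDl.
move=> /(_ _)/andP[|z3 z4]; first lra.
by rewrite ler_norml; lra.
Unshelve. all: by end_near. Qed.

End DelayedConsensus.

(** * Potentials and stationary weights on a digraph *)

Section WeightedDigraph.
Variables (R : realType) (N : nat) (w : 'I_N -> 'I_N -> R).
Hypothesis w_ge0 : forall i j, 0 <= w i j.
Implicit Types (i j k r : 'I_N) (b : 'I_N -> R).

Local Notation reach := (connect (fun j k => 0 < w k j)).

(** Ancestors of [v] are closed under in-neighbours, so at a maximizer of [b] among them every term
    with nonzero weight is at most 0. *)
Lemma ancestors_drift_le b (v : 'I_N) (q om : R) :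
  (forall i, reach i v -> om = q + \sum_j w i j * (b j - b i)) -> om <= q.
Proof.
move=> hb.
case: (@arg_maxP _ _ _ v (fun i => reach i v) b) => [|i iv imax]; first exact: connect0.
rewrite (hb i iv) gerDl; apply: sumr_le0 => j _.
have [->|wn0] := eqVneq (w i j) 0; first by rewrite mul0r.
rewrite mulr_ge0_le0// subr_le0; apply: imax; apply: connect_trans iv.
by apply: connect1; rewrite lt_neqAle eq_sym wn0 w_ge0.
Qed.

Lemma ancestors_drift_eq b (v : 'I_N) (q om : R) :
  (forall i, reach i v -> om = q + \sum_j w i j * (b j - b i)) -> om = q.
Proof.
move=> hb; apply/eqP; rewrite eq_le (ancestors_drift_le hb)/= -lerN2.
apply: (@ancestors_drift_le (fun i => - b i) v) => i iv.
rewrite (hb i iv) opprD -sumrN; congr (_ + _); apply: eq_bigr => j _; ring.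
Qed.

(** At a maximizer no in-neighbour can have a smaller value, so the maximum travels back along a
    path to the root. *)
Lemma subharmonic_root_max b r : (forall i, reach r i) ->
  (forall i, \sum_j w i j * (b i - b j) <= 0) -> forall i, b i <= b r.
Proof.
move=> r_root hb i0.
case: (@arg_maxP _ _ _ r xpredT b) => // i _ imax.
apply: (le_trans (imax i0 isT)).
suff /(_ (lexx _)) : b i <= b i -> b i <= b r by [].
apply: (connect_ind (P := fun x => b i <= b x -> b i <= b r) _ (r_root i)) => // x y wyx + iy.
apply; have := hb y; rewrite (bigD1 x)//= => H.
have : w y x * (b y - b x) <= 0.
  apply: le_trans H; rewrite lerDl; apply: sumr_ge0 => j _.
  by rewrite mulr_ge0// subr_ge0 (le_trans _ iy)//; exact: imax.
by rewrite pmulr_rle0// subr_le0; exact: le_trans.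
Qed.

(** Potentials matter only up to a constant, so [b r = om] may be imposed; the system becomes square
    and solvability reduces to injectivity. *)
Lemma drift_solvable (p q : 'I_N -> R) r : (forall i, reach r i) ->
  (forall i, 0 < p i) ->
  exists b om, forall i, q i + \sum_j w i j * (b j - b i) = om * p i.
Proof.
move=> r_root p_gt0.
(* the common drift [om] is encoded as the potential of the root *)
pose A : 'M[R]_N := \matrix_(j, i)
  ((j == i)%:R * (\sum_k w i k) - w i j + (j == r)%:R * p i).
have AE (v : 'rV_N) i :
    (v *m A) 0 i = \sum_j w i j * (v 0 i - v 0 j) + v 0 r * p i.
  rewrite mxE.
  under eq_bigr do rewrite mxE mulrDr mulrBr.
  rewrite big_split sumrB/=; congr (_ + _).
    rewrite (bigD1 i)//= eqxx mul1r [X in _ + X - _]big1 ?addr0; last first.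
      by move=> j /negPf ->; rewrite mul0r mulr0.
    by rewrite mulr_sumr -sumrB; apply: eq_bigr => j _; ring.
  rewrite (bigD1 r)//= eqxx mul1r big1 ?addr0// => j /negPf ->.
  by rewrite mul0r mulr0.
(* A kernel vector with [v 0 r >= 0] is subharmonic, hence maximal at [r], and the equation at [r]
   then forces [v 0 r <= 0]. Applied to [v] and [- v], this kills the kernel. *)
have half (v : 'rV_N) : v *m A = 0 -> 0 <= v 0 r -> v 0 r = 0 /\ forall i, v 0 i <= 0.
  move=> vA v0; have vE i : \sum_j w i j * (v 0 i - v 0 j) = - (v 0 r * p i).
    by apply/eqP; rewrite -addr_eq0 -AE vA mxE.
  have vmax := @subharmonic_root_max (v 0) r r_root _.
  have {}vmax i : v 0 i <= v 0 r.
    by apply: vmax => k; rewrite vE oppr_le0 mulr_ge0// ltW.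
  have vr0 : v 0 r = 0.
    apply/eqP; rewrite eq_le v0 andbT -(pmulr_lle0 _ (p_gt0 r)) -oppr_ge0 -vE.
    by apply: sumr_ge0 => j _; rewrite mulr_ge0// subr_ge0.
  by split => // i; rewrite -vr0.
have /mulmxKV AK : A \in unitmx.
  rewrite -row_free_unit; apply: inj_row_free => v vA.
  have NvA : - v *m A = 0 by rewrite mulNmx vA oppr0.
  have v_eq0 : v 0 r = 0.
    case: (lerP 0 (v 0 r)) => v0; first by have [] := half v vA v0.
    have [] := half _ NvA; rewrite mxE; first by rewrite oppr_ge0 ltW.
    by move=> /eqP; rewrite oppr_eq0 => /eqP.
  have v_le0 i : v 0 i <= 0 by apply: (half v vA _).2; rewrite v_eq0.
  have v_ge0 i : (- v) 0 i <= 0 by apply: (half _ NvA _).2; rewrite mxE v_eq0 oppr0.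
  apply/rowP => i; rewrite mxE; apply/eqP; rewrite eq_le v_le0/=.
  by have := v_ge0 i; rewrite mxE oppr_le0.
pose v : 'rV_N := \row_i q i *m invmx A.
exists (v 0), (v 0 r) => i.
have : (v *m A) 0 i = q i by rewrite AK mxE.
rewrite AE => <-; rewrite addrAC -big_split/= big1 ?add0r// => j _; ring.
Qed.

(** By the balance at a node, positivity of [gam] passes to its in-neighbours, hence to all
    ancestors of [k0]. The converse rests on the set of roots leaking no flow. *)
Lemma flow_balance_support (gam : 'I_N -> R) r :
  (forall i, reach r i) -> (forall i, 0 <= gam i) -> (exists k, 0 < gam k) ->
  (forall i, gam i * (\sum_k w i k) = \sum_k gam k * w k i) ->
  forall i, 0 < gam i <-> forall j, reach i j.
Proof.
move=> r_root gam_ge0 [k0 gk0] bal i; split; last first.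
  move=> /(_ k0) ik; suff : 0 < gam k0 -> 0 < gam i by apply.
  apply: (connect_ind (P := fun x => 0 < gam x -> 0 < gam i) _ ik) => // x y wyx + gy.
  apply; rewrite lt_neqAle gam_ge0 andbT eq_sym; apply/eqP => gx.
  have := bal x; rewrite gx mul0r => /esym/eqP; rewrite gt_eqF// (bigD1 y)//=.
  rewrite ltr_pwDl ?mulr_gt0//; apply: sumr_ge0 => j _; exact: mulr_ge0.
(* no weight flows from outside the set of roots into it, so summing the
   balance over the roots leaves no flow out of it *)
suff noflow x y : reach x r -> ~~ reach y r -> gam y * w y x = 0.
  move=> gi j; apply: connect_trans (r_root j).
  suff /(_ gi) : 0 < gam i -> reach i r by [].
  apply: (connect_ind (P := fun x => 0 < gam x -> reach x r) _ (r_root i)) => // x y wyx IH gy.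
  have gx : 0 < gam x.
    rewrite lt_neqAle gam_ge0 andbT eq_sym; apply/eqP => gx.
    have := bal x; rewrite gx mul0r => /esym/eqP; rewrite gt_eqF// (bigD1 y)//=.
    rewrite ltr_pwDl ?mulr_gt0//; apply: sumr_ge0 => k _; exact: mulr_ge0.
  apply/contraT => yr; have /eqP := noflow x y (IH gx) yr.
  by rewrite gt_eqF// mulr_gt0.
move=> xr yr; pose S z := reach z r.
have : \sum_(z | S z) gam z * (\sum_k w z k) = \sum_(z | S z) \sum_k gam k * w k z.
  by apply: eq_bigr => z _.
(* An in-neighbour of a root is again a root, so the left side involves only pairs of roots. *)
have -> : \sum_(z | S z) gam z * (\sum_k w z k) = \sum_(z | S z) \sum_(k | S k) gam k * w k z.
  rewrite [RHS]exchange_big/=; apply: eq_bigr => z Sz.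
  rewrite mulr_sumr (bigID S)/= [X in _ + X]big1 ?addr0// => k nSk.
  have [->|wn0] := eqVneq (w z k) 0; first by rewrite mulr0.
  case/negP: nSk; apply: connect_trans Sz; apply: connect1.
  by rewrite lt_neqAle eq_sym wn0 w_ge0.
have -> : \sum_(z | S z) \sum_k gam k * w k z =
    \sum_(z | S z) \sum_(k | S k) gam k * w k z + \sum_(z | S z) \sum_(k | ~~ S k) gam k * w k z.
  by rewrite -big_split; apply: eq_bigr => z _; rewrite (bigID S).
move=> /esym/eqP; rewrite -subr_eq0 addrAC subrr add0r => /eqP H.
have H0 z : S z -> 0 <= \sum_(k | ~~ S k) gam k * w k z.
  by move=> _; apply: sumr_ge0 => k _; exact: mulr_ge0.
have := psumr_eq0P H0 H xr; move=> {}H.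
by apply: (psumr_eq0P _ H) => // k _; exact: mulr_ge0.
Qed.

End WeightedDigraph.

(** * The network, its drift equation and the necessity of a root *)

Section Network.
Variables (R : realType) (N : nat) (K : R) (c : 'I_N -> R) (a : 'I_N -> 'I_N -> R).
Hypotheses (hK : 0 < K) (hc : forall i, 0 < c i)
  (ha : forall i j, i != j -> 0 <= a i j).
Implicit Types (i j r : 'I_N) (t : R) (tau : 'I_N -> 'I_N -> R).

(** Built on [adjmx], so the diagonal vanishes whatever [a i i] is and sums may range over all
    nodes. *)
Definition rate i j := K / c i * adjmx a i j.

Lemma adjmx_ge0 i j : 0 <= adjmx a i j.
Proof. by rewrite mxE; case: eqVneq => // /ha. Qed.

Lemma rate_ge0 i j : 0 <= rate i j.
Proof. by rewrite mulr_ge0 ?adjmx_ge0// divr_ge0// ltW. Qed.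

Lemma edge_adjmx i j : edge a j i = (0 < adjmx a i j).
Proof. by rewrite /edge mxE eq_sym; case: eqVneq => //=; rewrite ltxx. Qed.

Lemma edge_rate i j : edge a j i = (0 < rate i j).
Proof. by rewrite edge_adjmx pmulr_rgt0// divr_gt0. Qed.

Lemma reaches_rate i j : reaches a i j = connect (fun j k => 0 < rate k j) i j.
Proof. by apply: eq_connect => k l; rewrite edge_rate. Qed.

Lemma reaches_adjmx i j : reaches a i j = connect (fun j k => 0 < adjmx a k j) i j.
Proof. by apply: eq_connect => k l; rewrite edge_adjmx. Qed.

Lemma sum_nbrs i (F : 'I_N -> R) :
  \sum_(j in nbrs a i) a i j * F j = \sum_j adjmx a i j * F j.
Proof.
rewrite big_mkcond; apply: eq_bigr => j _; rewrite unfold_in/= mxE eq_sym.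
by case: eqVneq => [|_]/=; rewrite ?mul0r//; case: eqVneq => [->|]//=; rewrite mul0r.
Qed.

Lemma rhsE g y tau (x : 'I_N -> R -> R) i t :
  rhs K c a g y tau x i t =
    g i (y i) + \sum_j rate i j * (x j (t - tau i j) - x i t).
Proof.
by rewrite /rhs sum_nbrs mulr_sumr; congr (_ + _); apply: eq_bigr => j _; rewrite mulrA.
Qed.

Lemma taumax_ge0 tau : 0 <= taumax tau.
Proof. exact: bigmax_ge_id. Qed.

Lemma le_taumax tau i j : j != i -> tau i j <= taumax tau.
Proof.
move=> ji; apply: le_trans (le_bigmax _ _ i).
exact: (le_bigmax_cond 0 (tau i)).
Qed.

(** Common ancestors are merged one node at a time along the enumeration; [i0] starts the
    process. *)
Lemma QSC_root (i0 : 'I_N) : QSC a -> exists r, forall i, reaches a r i.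
Proof.
move=> qsc; suff [r rP] : exists r, forall i, i \in enum 'I_N -> reaches a r i.
  by exists r => i; apply: rP; rewrite mem_enum.
elim: (enum _) => [|i s [r IH]]; first by exists i0.
have [u [ui ur]] := qsc i r; exists u => j.
by rewrite inE => /predU1P[->//|/IH]; exact: connect_trans.
Qed.

Lemma sync_state_QSC :
  (forall g y, exists om, sync_state K c a g y (fun _ _ => 0) om) -> QSC a.
Proof.
move=> sync u v; apply: contrapT => noroot.
pose g i (_ : R) : R := (reaches a i u)%:R.
have [om [phi [x [_ [sol der]]]]] := sync g (fun=> 0).
(* Uniqueness of the derivative at time 1, an arbitrary positive instant, gives a static equation
   with potentials [x j 1]. *)
have eqom i : om = g i 0 + \sum_j rate i j * (x j 1 - x i 1).
  have [_ [_ /(_ 1 ltr01) d1]] := sol i; have d2 := der i 1 ltr01.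
  rewrite -[LHS](@derive_val _ _ _ _ _ _ _ d2) (@derive_val _ _ _ _ _ _ _ d1) rhsE.
  by under eq_bigr do rewrite subr0.
have /eqP := oner_neq0 R; apply.
transitivity om.
  apply/esym/(ancestors_drift_eq rate_ge0 (b := x ^~ 1) (v := u)) => i.
  by rewrite -reaches_rate => iu; rewrite {1}(eqom i) /g iu.
apply: (ancestors_drift_eq rate_ge0 (b := x ^~ 1) (v := v)) => i.
rewrite -reaches_rate => iv; rewrite {1}(eqom i) /g; case: (boolP (reaches a i u)) => // iu.
by case: noroot; exists i.
Qed.

(** * Convergence to the drift, its value and the support of [gamma] *)

Section Synchronization.
Variables (g : 'I_N -> R -> R) (y : 'I_N -> R) (tau : 'I_N -> 'I_N -> R).
Hypothesis tau_ge0 : forall i j, i != j -> 0 <= tau i j.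

Lemma glob_sync_to_drift r (b : 'I_N -> R) (om : R) :
  (forall i, reaches a r i) ->
  (forall i, g i (y i) + \sum_j rate i j * (b j - om * tau i j - b i) = om) ->
  glob_sync_to K c a g y tau om.
Proof.
move=> r_root hb; split.
  pose x i t := om * t + b i.
  have xc i : continuous (x i).
    by move=> t; apply: cvgD; [apply: cvgM; [exact: cvg_cst|exact: cvg_id]|exact: cvg_cst].
  have xd i (t : R) : is_derive t 1 (x i) om.
    have H : is_derive t 1 (fun t : R => om * t) om.
      by apply: is_derive_eq; rewrite scaler1.
    by apply: is_derive_eq; rewrite addr0.
  exists x, x; split; [|split] => // i.
    split; first exact: continuous_subspaceT.
    exists (`|om| * taumax tau + `|b i|) => t tT.
    rewrite (le_trans (ler_normD _ _))// lerD2r normrM ler_wpM2l// ler_norml; lra.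
  split=> //; split=> [|t t0]; first exact: continuous_subspaceT.
  apply: (is_derive_eq (xd i t)).
  rewrite rhsE -[LHS](hb i); congr (_ + _); apply: eq_bigr => j _; rewrite /x; ring.
move=> phi x adm sol i.
(* [tau i i] is unconstrained and ignored by [taumax]; setting it to 0 gives [0 <= d <= taumax tau],
   and the zero diagonal of [rate] leaves the flow unchanged. *)
pose d i j := if j == i then 0 else tau i j.
have d_ge0 j k : 0 <= d j k by rewrite /d; case: eqVneq => // kj; rewrite tau_ge0// eq_sym.
have d_le j k : d j k <= taumax tau.
  by rewrite /d; case: eqVneq => [_|]; [exact: taumax_ge0|exact: le_taumax].
have rate_d j k (F : R -> R) : rate j k * F (d j k) = rate j k * F (tau j k).
  by rewrite /d /rate mxE eq_sym; case: eqVneq => // _; rewrite mulr0 !mul0r.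
pose z j t := x j t - (om * t + b j).
have rhs_z j t : rhs K c a g y tau x j t - om = \sum_k rate j k * (z k (t - d j k) - z j t).
  rewrite rhsE -[X in _ - X](hb j) opprD addrACA subrr add0r -sumrB.
  apply: eq_bigr => k _.
  rewrite (rate_d j k (fun s => z k (t - s) - z j t)) /z; ring.
have zflow : consensus_flow rate d z.
  move=> j; have [_ [xc xd]] := sol j; split.
    move=> t; apply: cvgB.
      have T0 := taumax_ge0 tau.
      by apply: (continuous_subspaceW _ xc) => s /=; lra.
    have : continuous (fun t : R => om * t + b j).
      by move=> s; apply: cvgD; [apply: cvgM; [exact: cvg_cst|exact: cvg_id]|exact: cvg_cst].
    by move=> /continuous_subspaceT; exact.
  move=> t t0; rewrite -rhs_z; have dx := xd t t0.
  have H : is_derive t 1 (fun t : R => om * t + b j) om.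
    have H : is_derive t 1 (fun t : R => om * t) om.
      by apply: is_derive_eq; rewrite scaler1.
    by apply: is_derive_eq; rewrite addr0.
  exact: is_deriveB.
have [M zM] : exists M : R, forall j t, - taumax tau <= t <= 0 -> `|z j t| <= M.
  have /fin_all_exists[M0 M0P] : forall j, exists M : R, forall t, - taumax tau <= t <= 0 -> `|z j t| <= M.
    move=> j; have [_ [M xM]] := adm j; have [x_init _] := sol j.
    exists (M + (`|om| * taumax tau + `|b j|)) => t tT.
    rewrite (le_trans (ler_normB _ _))// lerD ?x_init ?xM//.
    rewrite (le_trans (ler_normD _ _))// lerD2r normrM ler_wpM2l// ler_norml; lra.
  exists (\big[Num.max/0]_j M0 j) => j t tT.
  by apply: le_trans (le_bigmax _ _ j); exact: M0P.
have r_root' j : connect (fun j k => 0 < rate k j) r j by rewrite -reaches_rate.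
have := consensus_flow_derive_cvg0 rate_ge0 d_ge0 d_le r_root' zflow zM i.
move=> /cvgr0Pnorm_le H; apply/cvgr0Pnorm_le => e /H{}H.
near=> t; rewrite normr_id derive1E.
have [_ [_ xd]] := sol i.
have t0 : 0 < t by near: t; apply: nbhs_pinfty_gt; exact: num_real.
rewrite (@derive_val _ _ _ _ _ _ _ (xd t t0)) rhs_z; near: t; exact: H.
Unshelve. all: by end_near. Qed.

(** Moving the delay terms to the right gives [om] the positive coefficient
    [1 + \sum_j rate i j * tau i j], as [drift_solvable] requires. *)
Lemma root_drift r : (forall i, reaches a r i) -> exists b om, forall i,
  g i (y i) + \sum_j rate i j * (b j - om * tau i j - b i) = om.
Proof.
move=> r_root; pose p i := 1 + \sum_j rate i j * tau i j.
have r_root' j : connect (fun j k => 0 < rate k j) r j by rewrite -reaches_rate.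
have p0 i : 0 < p i.
  rewrite ltr_pwDl//; apply: sumr_ge0 => j _; have [->|ij] := eqVneq j i.
    by rewrite /rate mxE eqxx mulr0 mul0r.
  by rewrite mulr_ge0 ?rate_ge0// tau_ge0// eq_sym.
have [b [om hb]] := drift_solvable rate_ge0 (fun i => g i (y i)) r_root' p0.
exists b, om => i; have := hb i; rewrite /p mulrDr mulr1 => E.
rewrite -[RHS](addrK (om * \sum_j rate i j * tau i j)) -E mulr_sumr -addrA -sumrB.
congr (_ + _).
apply: eq_bigr => j _; ring.
Qed.

Variable gamma : 'rV[R]_N.
Hypotheses (gammaL : gamma *m laplacian a = 0)
  (gamma_norm : Num.sqrt (\sum_(i < N) gamma 0 i ^+ 2) = 1)
  (gamma_ge0 : forall i, 0 <= gamma 0 i).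

Lemma gamma_balance i :
  gamma 0 i * (\sum_k adjmx a i k) = \sum_k gamma 0 k * adjmx a k i.
Proof.
have := congr1 (fun M : 'rV_N => M 0 i) gammaL; rewrite !mxE.
under eq_bigr => j _ do rewrite [laplacian _ _ _]mxE [degmx _ _ _]mxE [(- adjmx a) _ _]mxE mulrBr.
rewrite sumrB => /eqP; rewrite subr_eq0 => /eqP <-.
rewrite [RHS](bigD1 i)//= eqxx [X in _ + X]big1 ?addr0// => j /negPf ->; exact: mulr0.
Qed.

Lemma gamma_pos : exists i, 0 < gamma 0 i.
Proof.
apply: contrapT => gpos; have /eqP := oner_neq0 R; apply.
rewrite -gamma_norm big1 ?sqrtr0// => i _; apply/eqP; rewrite sqrf_eq0 eq_le gamma_ge0.
by rewrite andbT leNgt; apply/negP => gi; apply: gpos; exists i.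
Qed.

(** The weight [gamma 0 i * c i] cancels the [c i] in [rate], and summation removes the unknown
    potentials because [gamma] is in the left kernel. *)
Lemma drift_omega_star (b : 'I_N -> R) (om : R) :
  (forall i, g i (y i) + \sum_j rate i j * (b j - om * tau i j - b i) = om) ->
  om = omega_star K c a g y tau gamma.
Proof.
move=> hb; rewrite /omega_star; have [k gk] := gamma_pos.
under [X in _ / (_ + K * X)]eq_bigr => i _.
  under eq_bigr => j _ do rewrite -mulrA mulrCA.
  rewrite sum_nbrs; over.
set P := \sum_(i < N) gamma 0 i * c i; set Q := \sum_(i < N) \sum_j _.
have P0 : 0 < P.
  rewrite /P (bigD1 k)//= ltr_pwDl ?mulr_gt0//.
  by apply: sumr_ge0 => i _; rewrite mulr_ge0// ltW.
have Q0 : 0 <= Q.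
  apply: sumr_ge0 => i _; apply: sumr_ge0 => j _; have [->|ij] := eqVneq j i.
    by rewrite mxE eqxx mul0r.
  by rewrite mulr_ge0 ?adjmx_ge0// mulr_ge0// tau_ge0// eq_sym.
have PQ : P + K * Q != 0 by rewrite gt_eqF// ltr_pwDl// mulr_ge0// ltW.
apply: (mulIf PQ); rewrite mulfVK//.
have flow0 : \sum_(i < N) \sum_j gamma 0 i * adjmx a i j * (b j - b i) = 0.
  under eq_bigr do (under eq_bigr do rewrite mulrBr; rewrite sumrB).
  rewrite sumrB exchange_big/= -sumrB big1// => i _.
  by rewrite -!mulr_suml -mulr_sumr gamma_balance subrr.
have gcb i : gamma 0 i * c i * om = gamma 0 i * c i * g i (y i) +
   K * (\sum_j gamma 0 i * adjmx a i j * (b j - b i)) - om * (K * (\sum_j adjmx a i j * (gamma 0 i * tau i j))).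
  rewrite -[in LHS](hb i) mulrDr -addrA; congr (_ + _).
  rewrite !mulr_sumr -sumrB; apply: eq_bigr => j _; rewrite /rate; field.
  by rewrite gt_eqF.
rewrite mulrDr [om * P]mulrC /P mulr_suml (eq_bigr _ (fun i _ => gcb i)).
by rewrite sumrB big_split/= -!mulr_sumr flow0 mulr0 addr0 subrK.
Qed.

Lemma gamma_support r : (forall i, reaches a r i) ->
  forall i, 0 < gamma 0 i <-> forall j, j != i -> reaches a i j.
Proof.
move=> r_root i.
have r_root' j : connect (fun j k => 0 < adjmx a k j) r j by rewrite -reaches_adjmx.
have [gi ig] := flow_balance_support adjmx_ge0 r_root' gamma_ge0 gamma_pos gamma_balance i.
split=> [/gi ij j _|ij]; first by rewrite reaches_adjmx.
apply: ig => j; rewrite -reaches_adjmx; have [->|/ij//] := eqVneq j i.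
exact: connect0.
Qed.

End Synchronization.
End Network.

(** * The equivalence and the value of the drift *)

Theorem theorem1 (R : realType) (N : nat) (K : R) (c : 'I_N -> R)
    (a : 'I_N -> 'I_N -> R)
    (hK : 0 < K) (hc : forall i, 0 < c i)
    (ha : forall i j, i != j -> 0 <= a i j) :
  ((forall (g : 'I_N -> R -> R) (y : 'I_N -> R) (tau : 'I_N -> 'I_N -> R),
      (forall i j, i != j -> 0 <= tau i j) -> glob_sync K c a g y tau)
    <-> QSC a)
  /\
  (QSC a ->
   forall (g : 'I_N -> R -> R) (y : 'I_N -> R) (tau : 'I_N -> 'I_N -> R),
     (forall i j, i != j -> 0 <= tau i j) ->
     forall gamma : 'rV[R]_N,
       gamma *m laplacian a = 0 ->
       Num.sqrt (\sum_(i < N) gamma 0 i ^+ 2) = 1 ->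
       (forall i, 0 <= gamma 0 i) ->
       glob_sync_to K c a g y tau (omega_star K c a g y tau gamma) /\
       (forall i, 0 < gamma 0 i <-> (forall j, j != i -> reaches a i j))).
Proof.
split; first split.
- move=> sync; apply: (sync_state_QSC hK hc ha) => g y.
  by have [|om [syn _]] := sync g y (fun _ _ => 0); [|exists om].
(* An empty network has no root to choose, but every drift synchronizes it vacuously. *)
- move=> qsc g y tau tau_ge0; have [i0 _|N0] := pickP 'I_N; last first.
    exists 0; split; last by move=> ? ? ? ? i; have := N0 i.
    by exists (fun _ _ => 0), (fun _ _ => 0); split; [|split] => i; have := N0 i.
  have [r r_root] := QSC_root i0 qsc.
  have [b [om hb]] := root_drift hK hc ha g y tau_ge0 r_root.
  by exists om; exact: (glob_sync_to_drift hK hc ha tau_ge0 r_root hb).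
move=> qsc g y tau tau_ge0 gamma gL gn g0.
(* The unit norm of [gamma] excludes the empty network. *)
have [i0 _] := gamma_pos gn g0.
have [r r_root] := QSC_root i0 qsc.
have [b [om hb]] := root_drift hK hc ha g y tau_ge0 r_root.
rewrite -(drift_omega_star hK hc ha tau_ge0 gL gn g0 hb).
split; first exact: (glob_sync_to_drift hK hc ha tau_ge0 r_root hb).
exact: (gamma_support ha gL gn g0 r_root).
Qed.
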